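(* Let any integer $k \geq 1$ and any dimension $d\geq 1$ be given, and let $t,\alpha,\beta \geq 1$ be integers. There exists $f:\mathbb{R}^d \to \mathbb{R}$ computed by a neural network with standard ReLU gates in $2k^3+8$ layers, $3k^3 + 12$ total nodes, and $4+d$ distinct parameters so that \[ \inf_{g \in \mathcal{C}} \int_{[0,1]^d} |f(x)-g(x)|\,dx \geq \frac{1}{64}, \] where $\mathcal{C}$ is the union of the following two sets of functions: (i) functions computed by networks of $(t,\alpha,\beta)$-semi-algebraic gates in $\leq k$ layers and $\leq 2^{k}/(t\alpha\beta)$ nodes; (ii) functions computed by linear combinations of $\leq t$ decision trees each with $\leq 2^{k^3}/t$ nodes.
   Context: A neural network is given by a directed acyclic graph: layer 0 consists of the $d$ input coordinate maps $x\mapsto x_i$; each internal node applies a gate function to the outputs of its parent nodes (and to a shared parameter vector, parameters possibly reused across nodes); the unique node with no outgoing edges gives the output. A standard ReLU gate computes $v\mapsto \max\{0, \langle a, v\rangle + b\}$ for parameters $a,b$. A function $\phi:\mathbb{R}^k\to\mathbb{R}$ is $(t,\alpha,\beta)$-semi-algebraic if there exist $t$ polynomials $(q_i)_{i=1}^t$ of degree $\leq\alpha$ and finitely many triples $(U_j,L_j,p_j)_{j=1}^m$ with $U_j,L_j\subseteq\{1,\ldots,t\}$ and $p_j$ a polynomial of degree $\leq\beta$ such that $\phi(v)=\sum_{j=1}^m p_j(v)\prod_{i\in L_j}\mathbf{1}[q_i(v)<0]\prod_{i\in U_j}\mathbf{1}[q_i(v)\geq 0]$ (this includes standard ReLU gates,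 max/min gates of polynomials, and piecewise polynomial activations composed with polynomials). A decision tree with $k$ nodes is, for $k=1$, a constant function, and for $k>1$, evaluates $x\mapsto \mathbf{1}[\langle a,x\rangle - b\geq 0]$ and then conditionally evaluates a left decision tree with $l$ nodes or a right decision tree with $r$ nodes, where $l+r<k$. *)

(* Defs.v *)
From HB Require Import structures.
From mathcomp Require Import all_boot all_order all_algebra.
From mathcomp Require Import all_classical all_reals all_analysis.
From mathcomp Require mpoly.

Set Implicit Arguments.
Unset Strict Implicit.
Unset Printing Implicit Defensive.

Import Order.TTheory GRing.Theory Num.Theory.
Local Open Scope ring_scope.

Section Defs.
Variable R : realType.

(* Directed acyclic networks.
   Nodes are numbered in a topological order: global indices 0 .. d-1 are
   the layer-0 input coordinate nodes x |-> x_i, and internal node j < n has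
   global index d + j.  Internal node j has the parent list [net_par j]
   (global indices, all required to be < d + j, hence acyclicity), and
   applies the gate [net_gate j] to the vector of its parents' outputs. *)
Record network (d : nat) := Network {
  net_n : nat;
  net_par : nat -> seq nat;
  net_gate : forall j : nat, ('I_(size (net_par j)) -> R) -> R
}.

Definition net_wf d (N : network d) : Prop :=
  (0 < d + net_n N)%N /\
  (forall j, (j < net_n N)%N -> all (fun p => p < d + j)%N (net_par N j)) /\
  (* the last node is the unique node without outgoing edges *)
  (forall v, (v < (d + net_n N).-1)%N ->
     exists2 j, (j < net_n N)%N & v \in net_par N j).

Fixpoint net_vals d (N : network d) (x : 'rV[R]_d) (j : nat) : seq R :=
  match j with
  | 0 => [seq x ord0 i | i <- enum 'I_d]
  | j'.+1 =>
      let vs := net_vals N x j' in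
      rcons vs (@net_gate d N j' (fun i => nth 0 vs (nth 0%N (net_par N j') i)))
  end.

Definition net_eval d (N : network d) (x : 'rV[R]_d) : R :=
  nth 0 (net_vals N x (net_n N)) (d + net_n N).-1.

Fixpoint net_depths d (N : network d) (j : nat) : seq nat :=
  match j with
  | 0 => nseq d 0%N
  | j'.+1 =>
      let ds := net_depths N j' in
      rcons ds (\max_(p <- net_par N j') nth 0%N ds p).+1
  end.

Definition net_layers d (N : network d) : nat :=
  \max_(v <- net_depths N (net_n N)) v.

(* total number of (internal, i.e. gate) nodes *)
Definition net_nodes d (N : network d) : nat := net_n N.

(* Standard ReLU gates with a shared parameter vector w : 'I_p -> R:
   every weight a_i and the bias b of the gate is a coordinate of w. *)
Definition relu_gate_of (p : nat) (w : 'I_p -> R) (m : nat)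
    (phi : ('I_m -> R) -> R) : Prop :=
  exists (a : 'I_m -> 'I_p) (b : 'I_p),
    forall v, phi v = Num.max 0 (\sum_(i < m) w (a i) * v i + w b).

Definition relu_net_computes d (L Nn P : nat) (f : 'rV[R]_d -> R) : Prop :=
  exists (w : 'I_P -> R) (N : network d),
    [/\ net_wf N,
        (forall j, (j < net_n N)%N -> relu_gate_of w (@net_gate d N j)),
        net_layers N = L,
        net_nodes N = Nn &
        forall x, f x = net_eval N x].

Definition poly_deg_le m (q : mpoly.mpoly m R) (a : nat) : Prop :=
  all (fun mon => mpoly.mdeg mon <= a)%N (mpoly.msupp q).

Definition semi_algebraic (t alpha beta : nat) m (phi : ('I_m -> R) -> R)
    : Prop :=
  exists (q : 'I_t -> mpoly.mpoly m R) (M : nat)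
         (U L : 'I_M -> {set 'I_t}) (P : 'I_M -> mpoly.mpoly m R),
    (forall i, poly_deg_le (q i) alpha) /\
    (forall j, poly_deg_le (P j) beta) /\
    forall v, phi v =
      \sum_(j < M)
        mpoly.meval v (P j)
        * (\prod_(i in L j) (((mpoly.meval v (q i) < 0)%R)%:R))
        * (\prod_(i in U j) (((0 <= mpoly.meval v (q i))%R)%:R)).


Definition sa_net_computes d (t alpha beta L : nat) (Nmax : R)
    (g : 'rV[R]_d -> R) : Prop :=
  exists N : network d,
    [/\ net_wf N,
        (forall j, (j < net_n N)%N -> semi_algebraic t alpha beta (@net_gate d N j)),
        (net_layers N <= L)%N,
        ((net_nodes N)%:R <= Nmax) &
        forall x, g x = net_eval N x].

Inductive dtree (d : nat) : Type :=
| DLeaf of R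
| DNode of 'rV[R]_d & R & dtree d & dtree d.

Fixpoint dtree_size d (T : dtree d) : nat :=
  match T with
  | DLeaf _ => 1
  | DNode _ _ l r => (dtree_size l + dtree_size r).+1
  end.

Fixpoint dtree_eval d (T : dtree d) (x : 'rV[R]_d) : R :=
  match T with
  | DLeaf c => c
  | DNode a b l r =>
      if 0 <= \sum_(i < d) a ord0 i * x ord0 i - b
      then dtree_eval l x else dtree_eval r x
  end.

Definition dtree_comb_computes d (tmax : nat) (Smax : R) (g : 'rV[R]_d -> R)
    : Prop :=
  exists (m : nat) (c : 'I_m -> R) (T : 'I_m -> dtree d),
    [/\ (m <= tmax)%N,
        (forall i, (dtree_size (T i))%:R <= Smax) &
        forall x, g x = \sum_(i < m) c i * dtree_eval (T i) x].

(* Lebesgue integral over the unit cube [0,1]^d of a nonnegative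
   (extended-real valued) function, as the iterated integral w.r.t. the
   one-dimensional Lebesgue measure (Tonelli). *)
Definition rV_cons d (a : R) (y : 'rV[R]_d) : 'rV[R]_d.+1 :=
  \row_(i < d.+1) (if unlift ord0 i is Some j then y ord0 j else a).

Fixpoint cube_integral (d : nat) : ('rV[R]_d -> \bar R) -> \bar R :=
  match d with
  | 0 => fun F => F 0
  | d'.+1 => fun F =>
      (\int[@lebesgue_measure R]_(a in `[0%R, 1%R]) cube_integral
          (fun y => F (rV_cons a y)))%E
  end.

End Defs.

(* Main.v *)
(* Let f be the (k^3+4)-fold iterate of the tent map in the last coordinate:
   f consists of 2^(k^3+3) congruent triangles.  The cube integral is iterated
   with the last coordinate innermost, so it suffices to bound the integral
   along every line parallel to the last axis.  On such a line, g - 1/2 changes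
   sign at most 4 * 2^(k^3) times, i.e. in at most half of the triangles.  On a
   triangle where g - 1/2 has constant sign, |f - g| >= 1/4 on an interval of
   one eighth of its width, which gives 1/2 * 1/8 * 1/4 = 1/64.

   The sign change bound for networks: if on an interval all nodes of
   depth <= i are polynomials of degree <= beta^i, then cutting it at the roots
   of the at most n t polynomials tested by the next layer, each of degree
   <= alpha beta^i, leaves at most 1 + n t alpha beta^i intervals on each of
   which the next layer is polynomial of degree <= beta^(i+1).  As
   n t alpha beta <= 2^k, the product of these counts over k layers, times the
   beta^k + 1 sign intervals of the output, is at most 2^(k^3+2). *)

Require Import Defs.
From HB Require Import structures.
From mathcomp Require Import all_boot all_order all_algebra.
From mathcomp Require Import all_classical all_reals all_analysis.
From mathcomp Require mpoly.
From mathcomp Require Import zify ring lra.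

Set Implicit Arguments.
Unset Strict Implicit.
Unset Printing Implicit Defensive.

Import Order.TTheory GRing.Theory Num.Theory.
Local Open Scope ring_scope.

(** * Cutting intervals *)

Section Cut.
Variable R : realType.
Implicit Types (P Q : R -> R -> Prop) (l r u v c : R).

(* [l, r] splits into at most n consecutive, possibly degenerate, intervals satisfying P. *)
Fixpoint cut P (n : nat) l r : Prop :=
  if n is n'.+1 then
    P l r \/ exists c, [/\ l <= c, c <= r, P l c & cut P n' c r]
  else False.

Definition hereditary P :=
  forall u v u' v', P u v -> u <= u' -> u' <= v' -> v' <= v -> P u' v'.

Lemma cut_mono P n m l r : (n <= m)%N -> cut P n l r -> cut P m l r.
Proof.
elim: n m l => [//|n IHn] [//|m] l /= le_nm [Plr|[c [lc cr Plc cutc]]].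
  by left.
by right; exists c; split=> //; apply: IHn.
Qed.

Lemma cut_cat P n m l c r : l <= c -> c <= r ->
  cut P n l c -> cut P m c r -> cut P (n + m) l r.
Proof.
elim: n l => [//|n IHn] l /= lc cr [Plc|[c' [lc' c'c Pl cutc]]] cutr.
  by right; exists c; split=> //; apply: (cut_mono _ cutr); rewrite leq_addl.
by right; exists c'; split=> //; [exact: le_trans cr|exact: IHn].
Qed.

(** Piece counts multiply under refinement; this turns the bound for one layer into a product over
    layers. *)
Lemma cut_bind P Q n m l r : l <= r ->
  (forall u v, u <= v -> P u v -> cut Q m u v) -> cut P n l r -> cut Q (n * m) l r.
Proof.
move=> lr PQ; elim: n l lr => [//|n IHn] l lr /= [Plr|[c [lc cr Plc cutc]]].
  by apply: (cut_mono _ (PQ _ _ lr Plr)); rewrite leq_addr.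
by rewrite mulSn; apply: (@cut_cat _ _ _ _ c) => //; [exact: PQ|exact: IHn].
Qed.

Lemma cut_imp P Q n l r : (forall u v, l <= u -> u <= v -> v <= r -> P u v -> Q u v) ->
  l <= r -> cut P n l r -> cut Q n l r.
Proof.
elim: n l => [//|n IHn] l PQ lr /= [Plr|[c [lc cr Plc cutc]]].
  by left; apply: PQ.
right; exists c; split=> //; first exact: PQ.
by apply: IHn => // u v cu; apply: PQ; apply: le_trans cu.
Qed.

(** At most one piece has [c] in its interior; splitting it there costs one piece, and heredity
    keeps [P] on both halves. *)
Lemma cut_insert P n l r c : hereditary P -> l <= r -> cut P n l r ->
  cut (fun u v => P u v /\ ~~ (u < c < v)) n.+1 l r.
Proof.
move=> hP; elim: n l => [//|n IHn] l lr.
have split_at b : P l b -> l < c < b ->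
    (P l c /\ ~~ (l < c < c)) /\ (P c b /\ ~~ (c < c < b)).
  move=> Plb /andP[/ltW lc /ltW cb]; rewrite ltxx andbF /=.
  by do !split=> //; apply: (hP _ _ _ _ Plb).
case=> [Plr|[b [lb br Plb cutb]]].
  have [lcr|lcr] := boolP (l < c < r); last by left.
  have [Plc Pcr] := split_at _ Plr lcr; move/andP: lcr => [/ltW lc /ltW cr].
  by right; exists c; split=> //; left.
have [lcb|lcb] := boolP (l < c < b); last first.
  by right; exists b; split=> //; apply: IHn.
have [Plc Pcb] := split_at _ Plb lcb; move/andP: lcb => [/ltW lc /ltW cb].
right; exists c; split=> //; first exact: le_trans br.
right; exists b; split=> //.
apply: cut_imp cutb => // u v bu uv vr Puv; split=> //.
by rewrite negb_and -!leNgt (le_trans cb bu).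
Qed.

(** [B] collects the inner cut points: an interval with none of them in its interior lies inside a
    single piece. *)
Lemma cut_breaks P n l r : hereditary P -> cut P n l r ->
  exists2 B : seq R, (size B < n)%N &
    forall u v, l <= u -> u <= v -> v <= r -> all (fun b => ~~ (u < b < v)) B -> P u v.
Proof.
move=> hP; elim: n l => [//|n IHn] l /= [Plr|[c [lc cr Plc /IHn[B sB HB]]]].
  by exists [::] => // u v lu uv vr _; apply: hP Plr lu uv vr.
exists (c :: B) => // u v lu uv vr /= /andP[ncuv allB].
have [cu|uc] := leP c u; first exact: HB.
by apply: hP Plc lu uv _; move: ncuv; rewrite uc /= -leNgt.
Qed.

(** Induction on the degree: a root [c] strictly between [l] and [r] is factored out, and the pieces
    for the quotient are cut once more at [c]. *)
Lemma cut_nonroots n (p : {poly R}) l r : l <= r -> p != 0 -> (size p <= n.+1)%N ->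
  cut (fun u v => forall a, u < a < v -> ~~ root p a) n.+1 l r.
Proof.
move=> lr; elim: n p => [|n IHn] p p0 sp.
  left => a _; have /size_poly1P[c c0 ->] : size p == 1.
    by rewrite eqn_leq sp lt0n size_poly_eq0.
  by rewrite rootC.
have [[c /andP[lcr rc]]|nroot] := pselect (exists c, (l < c < r) && root p c); last first.
  by left=> a lar; apply/negP => ra; apply: nroot; exists a; rewrite lar.
have /factor_theorem[q pE] := rc.
have q0 : q != 0 by apply: contraNneq p0 => q0; rewrite pE q0 mul0r.
have sq : (size q <= n.+1)%N.
  by move: sp; rewrite pE size_mul ?polyXsubC_eq0// size_XsubC addn2.
have hq : hereditary (fun u v => forall a, u < a < v -> ~~ root q a).
  move=> u v u' v' H uu' _ vv' a /andP[u'a av']; apply: H.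
  by rewrite (le_lt_trans uu' u'a) (lt_le_trans av' vv').
have := cut_insert c hq lr (IHn q q0 sq).
apply: cut_imp => // u v _ _ _ [H ncuv] a auv.
rewrite pE rootM negb_or H//= root_XsubC.
by apply: contraNneq ncuv => <-.
Qed.

Lemma nonroots_sign (p : {poly R}) u v : (forall a, u < a < v -> ~~ root p a) ->
  {in [pred a | u < a < v] &, forall a b, (0 <= p.[a]) = (0 <= p.[b])}.
Proof.
move=> H; suff W a b : u < a < v -> u < b < v -> 0 <= p.[a] -> 0 <= p.[b].
  by move=> a b; rewrite !inE => ha hb; apply/idP/idP; apply: W.
move=> ha hb pa; rewrite leNgt; apply/negP => /ltW pb.
have [ab|ba] := leP a b.
  have [|x /andP[ax xb] rx] := @poly_ivt _ (- p) a b ab.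
    by rewrite !hornerN oppr_le0 oppr_ge0 pa pb.
  move/andP: ha => [ua _]; move/andP: hb => [_ bv].
  by have /negP := H x (introT andP (conj (lt_le_trans ua ax) (le_lt_trans xb bv)));
     apply; rewrite -rootN.
have [|x /andP[ax xb] rx] := @poly_ivt _ p b a (ltW ba); first by rewrite pa pb.
move/andP: ha => [_ av]; move/andP: hb => [ub _].
by have /negP := H x (introT andP (conj (lt_le_trans ub ax) (le_lt_trans xb av))).
Qed.

Definition signs_cst (s : seq {poly R}) u v := {in s, forall q : {poly R},
  {in [pred a | u < a < v] &, forall a b, (0 <= q.[a]) = (0 <= q.[b])}}.

(** All of [s] is handled at once by cutting at the roots of the product, of degree at most
    [size s * D]. Zero polynomials are left out of it, their sign being constant anyway. *)
Lemma cut_signs (s : seq {poly R}) D l r : l <= r ->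
  {in s, forall q : {poly R}, (size q <= D.+1)%N} ->
  cut (signs_cst s) (size s * D).+1 l r.
Proof.
move=> lr sD; pose p : {poly R} := \prod_(q <- s | q != 0) q.
have p0 : p != 0 by rewrite prodf_seq_neq0; apply/allP => q _; apply/implyP.
have sp : (size p <= (size s * D).+1)%N.
  rewrite /p; elim: s sD {p p0} => [|q s IHs] sD; first by rewrite big_nil size_poly1.
  have := IHs (fun q' qs => sD q' (@mem_behead _ (q :: s) q' qs)).
  have := sD q (mem_head _ _); rewrite big_cons /= mulSn -addnS; case: ifP => _ sq sIH.
    apply: leq_trans (size_polyMleq _ _) _.
    by rewrite -subn1 leq_subLR add1n -addSn; apply: leq_add.
  exact: leq_trans sIH (leq_addl _ _).
apply: cut_imp (cut_nonroots lr p0 sp) => // u v _ _ _ H q qs.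
have [->|q0] := eqVneq q 0; first by move=> a b _ _; rewrite !horner0.
apply: nonroots_sign => a /H; apply: contraNN => rqa.
rewrite /p (big_rem q)//= q0 rootM rqa //.
Qed.

End Cut.

(** * Lower bounds for possibly non-measurable integrands *)

Section Integral.
Variable R : realType.

(** The integral is a supremum over simple functions below the integrand, and those below [c] on [A]
    are also below [F] on [D]; so the bound covers non-measurable [F] too. *)
Lemma integral_ge_cst_subset (A D : set R) (F : R -> \bar R) (c : R) :
  measurable A -> (A `<=` D)%classic -> 0 <= c ->
  (forall a, D a -> (0 <= F a)%E) -> (forall a, A a -> (c%:E <= F a)%E) ->
  (c%:E * lebesgue_measure A <= \int[@lebesgue_measure R]_(a in D) F a)%E.
Proof.
move=> mA AD c0 F0 Fc; rewrite -integral_cst// ge0_integralE; last by move=> a _; rewrite lee_fin.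
rewrite ge0_integralE//; apply: ereal_sup_le => _ [h hle <-]; exists h => // a.
apply: le_trans (hle a) _; rewrite /patch; case: ifPn => [/[!inE] aA|_].
  by rewrite mem_set ?Fc//; apply: AD.
by case: ifPn => // /[!inE] /F0.
Qed.

Lemma integral_01_ge_cst (F : R -> \bar R) (c : R) : 0 <= c ->
  (forall a, 0 <= a <= 1 -> (c%:E <= F a)%E) ->
  (c%:E <= \int[@lebesgue_measure R]_(a in `[0%R, 1%R]) F a)%E.
Proof.
move=> c0 Fc; have Fc' a : `[0%R, 1%R]%classic a -> (c%:E <= F a)%E.
  by move=> /=; rewrite in_itv /= => /Fc.
apply: le_trans (@integral_ge_cst_subset _ _ F c _ (@subset_refl _ _) c0 _ Fc') => //.
  by rewrite lebesgue_measure_itv /= lte_fin ltr01 -EFinD subr0 -EFinM mulr1.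
by move=> a /Fc'; apply: le_trans; rewrite lee_fin.
Qed.

Definition set_last d (x : 'rV[R]_d.+1) (a : R) : 'rV[R]_d.+1 :=
  \row_i (if i == ord_max then a else x ord0 i).

(** [rV_cons] prepends coordinates, so the innermost integral runs over the last one; its lower
    bound [c] survives the outer integrals over intervals of length 1. *)
Lemma cube_integral_ge_last d (F : 'rV[R]_d.+1 -> \bar R) (c : R) : 0 <= c ->
  (forall x, (c%:E <= \int[@lebesgue_measure R]_(a in `[0%R, 1%R]) F (set_last x a))%E) ->
  (c%:E <= cube_integral F)%E.
Proof.
move=> c0; elim: d F => [|d IHd] F Fc.
  apply: le_trans (Fc 0) _; rewrite le_eqVlt; apply/orP; left; apply/eqP.
  apply: eq_integral => a _ /=; congr (F _); apply/rowP => i; rewrite !mxE ord1 /=.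
  by rewrite unlift_none.
apply: (@integral_01_ge_cst (fun a => cube_integral (fun y => F (rV_cons a y)))) => // a _.
apply: IHd => y.
apply: le_trans (Fc (rV_cons a y)) _; rewrite le_eqVlt; apply/orP; left; apply/eqP.
apply: eq_integral => b _ /=; congr (F _); apply/rowP => i; rewrite !mxE.
case: unliftP => [j ->|->]; last by rewrite -val_eqE.
by rewrite mxE -!val_eqE.
Qed.

Lemma integral_01_ge_pieces n (I : {set 'I_n}) (l r : 'I_n -> R) (F : R -> \bar R) (c h : R) :
  0 <= c -> (forall a, 0 <= a <= 1 -> (0 <= F a)%E) ->
  {in I, forall i : 'I_n, [/\ i%:R / n%:R <= l i, r i <= i.+1%:R / n%:R & 0 < h <= r i - l i]} ->
  {in I, forall i a, l i < a < r i -> (c%:E <= F a)%E} ->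
  ((c * (#|I|%:R * h))%:E <= \int[@lebesgue_measure R]_(a in `[0%R, 1%R]) F a)%E.
Proof.
move=> c0 F0 lr Fc.
pose A := (\big[setU/set0]_(i in I) `]l i, r i[)%classic.
have memA a : A a -> exists2 i, i \in I & l i < a < r i.
  rewrite /A -bigcup_seq_cond => -[i /= /andP[_ iI]]; rewrite in_itv /= => ai.
  by exists i.
have mA : measurable A by apply: bigsetU_measurable => i _; exact: measurable_itv.
have n0 (i : 'I_n) : (0 : R) < n%:R by rewrite ltr0n (leq_ltn_trans _ (ltn_ord i)).
have tA : trivIset [set i | i \in I] (fun i => `]l i, r i[)%classic.
  move=> i j /= iI jI [a []] /=; rewrite !in_itv /= => /andP[lia ari] /andP[lja arj].
  have [li ri _] := lr i iI; have [lj rj _] := lr j jI.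
  (* A common point of intervals [i] and [j] gives [i / n < (j + 1) / n] and symmetrically, hence
     [i = j]. *)
  have ltS (i1 i2 : 'I_n) : (i1%:R : R) / n%:R < i2.+1%:R / n%:R -> (i1 <= i2)%N.
    by rewrite ltr_pM2r ?invr_gt0 ?(n0 i)// ltr_nat ltnS.
  apply/val_inj/eqP; rewrite eqn_leq !ltS//.
    exact: le_lt_trans lj (lt_trans lja (lt_le_trans ari ri)).
  exact: le_lt_trans li (lt_trans lia (lt_le_trans arj rj)).
have muA : (((#|I|%:R * h)%:E) <= lebesgue_measure A)%E.
  rewrite /A measure_bigsetU_ord_cond//.
  rewrite mulr_natl -sumr_const -sumEFin; apply: lee_sum => i iI.
  have [_ _ /andP[h0 hi]] := lr i iI.
  suff : (h%:E <= lebesgue_measure (`]l i, r i[%classic : set R))%E by [].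
  by rewrite lebesgue_measure_itv /= lte_fin -subr_gt0 (lt_le_trans h0 hi) -EFinD lee_fin.
rewrite EFinM; apply: le_trans (lee_wpmul2l _ muA) _; first by rewrite lee_fin.
apply: integral_ge_cst_subset => //.
- move=> a /memA[i iI /andP[la ar]]; rewrite /= in_itv /=.
  have [li ri _] := lr i iI.
  have r1 : (i.+1%:R : R) / n%:R <= 1 by rewrite ler_pdivrMr ?(n0 i)// mul1r ler_nat.
  have l0 : (0 : R) <= i%:R / n%:R by rewrite divr_ge0.
  by rewrite (le_trans l0 (le_trans li (ltW la))) (le_trans (ltW ar) (le_trans ri r1)).
- by move=> a /memA[i iI]; exact: Fc.
Qed.

End Integral.

(** * Semi-algebraic networks *)

Section Networks.
Variable R : realType.

(** * Node values and depths read off the final lists *)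

Section RconsRec.
Variables (T : Type) (x0 : T) (d : nat) (s : nat -> seq T) (h : nat -> T).
Hypotheses (s0 : size (s 0%N) = d) (sS : forall j, s j.+1 = rcons (s j) (h j)).

Lemma size_rcons_rec j : size (s j) = (d + j)%N.
Proof. by elim: j => [|j IHj]; rewrite ?addn0// sS size_rcons IHj addnS. Qed.

Lemma nth_rcons_rec j n p : (p < d + j)%N -> (j <= n)%N -> nth x0 (s n) p = nth x0 (s j) p.
Proof.
move=> pj /subnK <-; elim: (n - j)%N => [//|i IHi].
rewrite addSn sS nth_rcons size_rcons_rec IHi; case: ltnP => //; lia.
Qed.

Lemma nth_rcons_rec_last j n : (j < n)%N -> nth x0 (s n) (d + j) = h j.
Proof.
move=> jn; rewrite (@nth_rcons_rec j.+1)// ?addnS//.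
by rewrite sS nth_rcons size_rcons_rec ltnn eqxx.
Qed.

End RconsRec.

Section NodeValues.
Variables (d : nat) (N : network R d).

Definition node_val (x : 'rV[R]_d) p := nth 0 (net_vals N x (net_n N)) p.
Definition node_depth p := nth 0%N (net_depths N (net_n N)) p.

Let size_vals0 (x : 'rV[R]_d) : size (net_vals N x 0) = d.
Proof. by rewrite size_map size_enum_ord. Qed.

Let size_depths0 : size (net_depths N 0) = d.
Proof. by rewrite size_nseq. Qed.

Lemma node_val_input (x : 'rV[R]_d) (i : 'I_d) : node_val x i = x ord0 i.
Proof.
have id : (i < d + 0)%N by rewrite addn0.
rewrite /node_val (nth_rcons_rec 0 (size_vals0 x) (fun=> erefl) id)//=.
by rewrite (nth_map i) ?size_enum_ord// nth_ord_enum.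
Qed.

Lemma node_depth_input p : (p < d)%N -> node_depth p = 0%N.
Proof.
move=> pd; have pd' : (p < d + 0)%N by rewrite addn0.
by rewrite /node_depth (nth_rcons_rec _ size_depths0 (fun=> erefl) pd')//= nth_nseq pd.
Qed.

Hypothesis wf : net_wf N.

Lemma mem_par_lt j p : (j < net_n N)%N -> p \in net_par N j -> (p < d + j)%N.
Proof. by move=> jn; have [_ [/(_ _ jn)/allP h _]] := wf; apply: h. Qed.

Lemma node_val_gate x j : (j < net_n N)%N ->
  node_val x (d + j) = @net_gate R d N j (fun i => node_val x (nth 0%N (net_par N j) i)).
Proof.
move=> jn; rewrite {1}/node_val (nth_rcons_rec_last 0 (size_vals0 x) (fun=> erefl) jn).
congr net_gate; apply/funext => i; rewrite /node_val.
rewrite -(nth_rcons_rec 0 (size_vals0 x) (fun=> erefl) _ (ltnW jn))//.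
by apply: mem_par_lt jn _; exact: mem_nth.
Qed.

Lemma node_depth_gate j : (j < net_n N)%N ->
  node_depth (d + j) = (\max_(p <- net_par N j) node_depth p).+1.
Proof.
move=> jn; rewrite {1}/node_depth (nth_rcons_rec_last 0 size_depths0 (fun=> erefl) jn).
congr _.+1; apply: eq_big_seq => p pj; rewrite /node_depth.
rewrite -(nth_rcons_rec 0 size_depths0 (fun=> erefl) _ (ltnW jn))//.
exact: mem_par_lt jn pj.
Qed.

Lemma node_depth_par j p : (j < net_n N)%N -> p \in net_par N j ->
  (node_depth p < node_depth (d + j))%N.
Proof.
by move=> jn pj; rewrite node_depth_gate// ltnS; apply: leq_bigmax_seq.
Qed.

Lemma size_net_depths : size (net_depths N (net_n N)) = (d + net_n N)%N.
Proof. exact: (size_rcons_rec size_depths0). Qed.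

Lemma node_depth_le_layers p : (p < d + net_n N)%N -> (node_depth p <= net_layers N)%N.
Proof.
by move=> pn; apply: (@leq_bigmax_seq _ _ _ id) => //; rewrite mem_nth// size_net_depths.
Qed.

End NodeValues.

(** The composition of [q] with the [p i], expanded over monomials so that its degree can be bounded
    along the support. *)
Definition mpoly_subst m (p : 'I_m -> {poly R}) (q : mpoly.mpoly m R) : {poly R} :=
  \sum_(mon <- mpoly.msupp q) mpoly.mcoeff mon q *: \prod_i p i ^+ mpoly.fun_of_multinom mon i.

Lemma horner_mpoly_subst m (p : 'I_m -> {poly R}) q a :
  (mpoly_subst p q).[a] = mpoly.meval (fun i => (p i).[a]) q.
Proof.
rewrite mpoly.mevalE horner_sum; apply: eq_bigr => mon _.
rewrite hornerZ horner_prod; congr *%R; apply: eq_bigr => i _.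
by rewrite horner_exp.
Qed.

Lemma size_mpoly_subst m (p : 'I_m -> {poly R}) q e D :
  (forall i, (size (p i) <= D.+1)%N) -> poly_deg_le q e ->
  (size (mpoly_subst p q) <= (e * D).+1)%N.
Proof.
move=> pD; rewrite /poly_deg_le /mpoly_subst.
elim: (mpoly.msupp q) => [|mon ms IHms] /=; first by rewrite big_nil size_poly0.
move=> /andP[mone /IHms {}IHms]; rewrite big_cons.
apply: leq_trans (size_polyD _ _) _; rewrite geq_max IHms andbT.
apply: leq_trans (size_scale_leq _ _) _.
apply: leq_trans (_ : (mpoly.mdeg mon * D).+1 <= _)%N; last by rewrite ltnS leq_mul2r mone orbT.
rewrite mpoly.mdegE big_distrl /=.
elim/big_rec2: _ => [|i r s _ IH]; first by rewrite size_poly1.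
apply: leq_trans (size_polyMleq _ _) _; rewrite -subn1 leq_subLR add1n -addnS -addSn.
apply: leq_add => //; apply: leq_trans (size_poly_exp_leq _ _) _.
rewrite ltnS mulnC leq_mul2l; apply/orP; right.
by rewrite -subn1 leq_subLR add1n.
Qed.

(** [s] holds the tested polynomials composed with the [p i]. Where their signs are constant, all
    indicators are frozen and the gate is a fixed linear combination of the composed [P j]. *)
Lemma semi_algebraic_subst t al be m (phi : ('I_m -> R) -> R) (p : 'I_m -> {poly R}) D :
  semi_algebraic t al be phi -> (forall i, (size (p i) <= D.+1)%N) ->
  exists s : seq {poly R}, [/\ size s = t,
    {in s, forall q : {poly R}, (size q <= (al * D).+1)%N} &
    forall u v, signs_cst s u v -> exists2 P : {poly R}, (size P <= (be * D).+1)%N &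
      forall a, u < a < v -> phi (fun i => (p i).[a]) = P.[a]].
Proof.
move=> [q [M [U [L [P [dq [dP phiE]]]]]]] pD.
exists [seq mpoly_subst p (q i) | i <- enum 'I_t]; split.
- by rewrite size_map size_enum_ord.
- by move=> _ /mapP[i _ ->]; apply: size_mpoly_subst.
move=> u v sgn; have [vu|uv] := leP v u.
  by exists 0; rewrite ?size_poly0// => a /andP[ua av]; move: (lt_trans ua av); rewrite ltNge vu.
(* Any inner point serves as a sample: the indicators on the whole interval are those at [c]. *)
have [c cuv] : exists c, u < c < v by exists ((u + v) / 2); rewrite !midf_lt.
have sg a i : u < a < v -> (0 <= mpoly.meval (fun i => (p i).[a]) (q i)) =
                         (0 <= mpoly.meval (fun i => (p i).[c]) (q i)).
  move=> auv; rewrite -!horner_mpoly_subst; apply: (sgn (mpoly_subst p (q i))) => //.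
  by apply/mapP; exists i; rewrite ?mem_enum.
pose vc := fun i => (p i).[c].
exists (\sum_(j < M) ((\prod_(i in L j) ((mpoly.meval vc (q i) < 0)%R)%:R)
        * (\prod_(i in U j) ((0 <= mpoly.meval vc (q i))%R)%:R)) *: mpoly_subst p (P j)).
  apply: (leq_trans (size_sum _ _ _)); apply/bigmax_leqP => j _.
  by apply: leq_trans (size_scale_leq _ _) _; apply: size_mpoly_subst.
move=> a auv; rewrite phiE horner_sum; apply: eq_bigr => j _.
rewrite hornerZ horner_mpoly_subst [RHS]mulrC -mulrA; congr (_ * (_ * _)).
  by apply: eq_bigr => i _; rewrite !ltNge sg.
by apply: eq_bigr => i _; rewrite sg.
Qed.

End Networks.

(** * Sign changes along a line *)

Section Breaks.
Variable R : realType.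

Definition half_cst (psi : R -> R) (u v : R) :=
  (forall a, u < a < v -> 1 / 2 <= psi a) \/ (forall a, u < a < v -> psi a <= 1 / 2).

Definition half_breaks (B : seq R) (psi : R -> R) := forall u v : R,
  0 <= u -> u <= v -> v <= 1 -> all (fun b => ~~ (u < b < v)) B -> half_cst psi u v.

Lemma half_cst_hereditary psi : hereditary (half_cst psi).
Proof.
move=> u v u' v' H uu' _ v'v.
have sub a : u' < a < v' -> u < a < v.
  by move=> /andP[ua av]; rewrite (le_lt_trans uu' ua) (lt_le_trans av v'v).
by case: H => H; [left|right] => a /sub; apply: H.
Qed.

Lemma cut_nodes d (N : network R d.+1) (x : 'rV[R]_d.+1) t al be i :
  net_wf N -> (0 < be)%N ->
  (forall j, (j < net_n N)%N -> semi_algebraic t al be (@net_gate R d.+1 N j)) ->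
  cut (fun u v => forall w, (w < d.+1 + net_n N)%N -> (node_depth N w <= i)%N ->
      exists2 p : {poly R}, (size p <= (be ^ i).+1)%N &
        forall a, u < a < v -> node_val N (set_last x a) w = p.[a])
    (\prod_(j < i) (net_n N * t * al * be ^ j).+1) 0 1.
Proof.
move=> wf be0 sa; elim: i => [|i IHi].
  rewrite big_ord0; left => w wn; rewrite leqn0 => dw.
  (* A gate has depth at least 1, so depth 0 leaves only the inputs; along the line only coordinate
     [d] varies. *)
  have wd : (w < d.+1)%N.
    rewrite ltnNge; apply/negP => dlew; move: dw.
    have -> : w = (d.+1 + (w - d.+1))%N by rewrite subnKC.
    by rewrite node_depth_gate// -(ltn_add2l d.+1) subnKC.
  exists (if w == d then 'X else (x ord0 (Ordinal wd))%:P).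
    by rewrite expn0; case: ifP => _; rewrite ?size_polyX// size_polyC; case: (_ != _).
  move=> a _; rewrite -[w]/(val (Ordinal wd)) node_val_input mxE -val_eqE /=.
  by case: ifP; rewrite ?hornerX ?hornerC.
rewrite big_ord_recr /=; apply: (cut_bind ler01 _ IHi) => u v uv Puv {IHi}.
have /choice[p pP] : forall w, exists pw : {poly R}, (w < d.+1 + net_n N)%N ->
    (node_depth N w <= i)%N -> (size pw <= (be ^ i).+1)%N /\
        forall a, u < a < v -> node_val N (set_last x a) w = pw.[a].
  move=> w.
  have [wn|] := ltnP w (d.+1 + net_n N); last by exists 0.
  have [wi|] := leqP (node_depth N w) i; last by exists 0.
  by have [q sq qE] := Puv w wn wi; exists q.
have /choice[s sP] : forall j, exists sj : seq {poly R}, (j < net_n N)%N ->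
    (node_depth N (d.+1 + j) <= i.+1)%N ->
    [/\ (size sj <= t)%N,
    {in sj, forall q : {poly R}, (size q <= (al * be ^ i).+1)%N} &
    forall u' v', u <= u' -> v' <= v -> signs_cst sj u' v' ->
      exists2 P : {poly R}, (size P <= (be ^ i.+1).+1)%N &
      forall a, u' < a < v' -> node_val N (set_last x a) (d.+1 + j) = P.[a]].
  move=> j.
  have [jn|] := ltnP j (net_n N); last by exists [::].
  have [ji|] := leqP (node_depth N (d.+1 + j)) i.+1; last by exists [::].
  have par k : k \in net_par N j -> (k < d.+1 + net_n N)%N /\ (node_depth N k <= i)%N.
    move=> kj; split; last by rewrite -ltnS (leq_trans (node_depth_par wf jn kj)).
    by apply: ltn_trans (mem_par_lt wf jn kj) _; rewrite ltn_add2l.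
  have [|s [st sD sE]] := @semi_algebraic_subst R t al be _ _
    (fun k => p (nth 0%N (net_par N j) k)) (be ^ i) (sa j jn).
    by move=> k; have [kn ki] := par _ (mem_nth 0%N (ltn_ord k)); have [] := pP _ kn ki.
  exists s => _ _; split=> //; first by rewrite st.
  move=> u' v' uu' vv' /sE[P sP PE]; exists P; first by rewrite expnS.
  move=> a auv; rewrite -PE// node_val_gate//; congr net_gate; apply/funext => k.
  have [kn ki] := par _ (mem_nth 0%N (ltn_ord k)); have [_ -> //] := pP _ kn ki.
  by move/andP: auv => [ua av]; rewrite (le_lt_trans uu' ua) (lt_le_trans av vv').
(* All gates of depth at most [i.+1] are treated afresh; [S] gathers every polynomial they test. *)
pose J := [seq j <- iota 0 (net_n N) | (node_depth N (d.+1 + j) <= i.+1)%N].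
have memJ j : (j \in J) = (node_depth N (d.+1 + j) <= i.+1)%N && (j < net_n N)%N.
  by rewrite mem_filter mem_iota.
pose S := flatten [seq s j | j <- J].
have sizeS : (size S <= net_n N * t)%N.
  have : (size J <= net_n N)%N by rewrite size_filter (leq_trans (count_size _ _))// size_iota.
  have : all (fun j => size (s j) <= t)%N J.
    by apply/allP => j; rewrite memJ => /andP[ji jn]; have [] := sP j jn ji.
  rewrite /S; elim: (J) (net_n N) => [|j J' IH] n //= /andP[sj /IH{}IH].
  by case: n => // n /IH{}IH; rewrite size_cat mulSn leq_add.
have SD : {in S, forall q : {poly R}, (size q <= (al * be ^ i).+1)%N}.
  move=> q /flatten_mapP[j]; rewrite memJ => /andP[ji jn].
  by have [_ + _] := sP j jn ji; apply.
apply: cut_mono (cut_imp _ uv (cut_signs uv SD)).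
  by rewrite ltnS -mulnA leq_mul2r sizeS orbT.
move=> u' v' uu' u'v' v'v sgn w wn wi.
(* Inputs keep their old polynomial: [be ^ i <= be ^ i.+1] as [be] is positive. *)
have [wd|dw] := ltnP w d.+1.
  have [] := pP w wn; first by rewrite node_depth_input.
  move=> sp pE; exists (p w).
    by rewrite (leq_trans sp)// ltnS leq_pexp2l.
  by move=> a /andP[ua av]; rewrite pE// (le_lt_trans uu' ua) (lt_le_trans av v'v).
have wE : w = (d.+1 + (w - d.+1))%N by rewrite subnKC.
have jn : (w - d.+1 < net_n N)%N by rewrite -(ltn_add2l d.+1) -wE.
rewrite wE in wi *; have [_ _] := sP _ jn wi; apply=> // q qs; apply: sgn.
by apply/flatten_mapP; exists (w - d.+1)%N; rewrite // memJ wi jn.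
Qed.

(** On each piece from [cut_nodes] the output is a polynomial of degree at most [be ^ i]; the last
    factor counts the cuts at the roots of its difference with 1/2. *)
Lemma sa_net_half_breaks d (N : network R d.+1) (x : 'rV[R]_d.+1) t al be i :
  net_wf N -> (0 < be)%N ->
  (forall j, (j < net_n N)%N -> semi_algebraic t al be (@net_gate R d.+1 N j)) ->
  (net_layers N <= i)%N ->
  exists2 B : seq R,
    (size B < (\prod_(j < i) (net_n N * t * al * be ^ j).+1) * (be ^ i).+1)%N &
    half_breaks B (fun a => net_eval N (set_last x a)).
Proof.
move=> wf be0 sa Li; apply: (cut_breaks (@half_cst_hereditary _)).
apply: (cut_bind ler01 _ (cut_nodes x i wf be0 sa)) => u v uv H.
have out : ((d.+1 + net_n N).-1 < d.+1 + net_n N)%N by rewrite addSn.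
have [p sp pE] := H _ out (leq_trans (node_depth_le_layers out) Li).
have sp' : {in [:: p - (1 / 2)%:P], forall q : {poly R}, (size q <= (be ^ i).+1)%N}.
  move=> q; rewrite inE => /eqP ->; apply: leq_trans (size_polyD _ _) _.
  by rewrite geq_max sp size_polyN size_polyC; case: (_ != _).
have := cut_signs uv sp'; rewrite mul1n; apply: cut_imp => // u' v' uu' u'v' v'v sgn.
have sub a : u' < a < v' -> u < a < v.
  by move=> /andP[ua av]; rewrite (le_lt_trans uu' ua) (lt_le_trans av v'v).
have pval a : u' < a < v' -> net_eval N (set_last x a) = p.[a] by move=> /sub /pE.
have [vu|{}uv] := leP v' u'.
  by left=> a /andP[ua av]; move: (lt_trans ua av); rewrite ltNge vu.
have [c cuv] : exists c, u' < c < v' by exists ((u' + v') / 2); rewrite !midf_lt.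
have sg a : u' < a < v' -> (1 / 2 <= p.[a]) = (1 / 2 <= p.[c]).
  move=> auv; have := sgn _ (mem_head _ _) a c auv cuv.
  by rewrite !hornerE !subr_ge0.
have [pc|/negbTE pc] := boolP (1 / 2 <= p.[c]); [left|right] => a auv; rewrite pval//.
  by rewrite sg.
by rewrite leNgt; apply/negP => /ltW; rewrite sg// pc.
Qed.

(** On the line every test is affine in the last coordinate and flips at most once, so each inner
    node contributes at most one break. *)
Lemma dtree_breaks d (x : 'rV[R]_d.+1) (T : dtree R d.+1) :
  exists2 B : seq R, (size B <= dtree_size T)%N &
    forall u v : R, all (fun b => ~~ (u < b < v)) B ->
      exists c, forall a, u < a < v -> dtree_eval T (set_last x a) = c.
Proof.
elim: T => [c|w b l [Bl sl Hl] r [Br sr Hr]]; first by exists [::] => //= u v _; exists c.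
pose p : {poly R} := w ord0 ord_max *: 'X +
  (\sum_(i < d.+1 | i != ord_max) w ord0 i * x ord0 i - b)%:P.
have pE a : \sum_(i < d.+1) w ord0 i * set_last x a ord0 i - b = p.[a].
  rewrite (bigD1 ord_max)//= mxE eqxx hornerD hornerZ hornerX hornerC -addrA; congr (_ + (_ - _)).
  by apply: eq_bigr => i /negbTE iN; rewrite mxE iN.
have [B sB HB] : exists2 B : seq R, (size B <= 1)%N &
    forall u v : R, all (fun b => ~~ (u < b < v)) B -> signs_cst [:: p] u v.
  have [w0|w0] := eqVneq (w ord0 ord_max) 0.
    exists [::] => // u v _ q; rewrite inE => /eqP -> a a' _ _.
    by rewrite /p w0 scale0r add0r !hornerC.
  exists [:: - (\sum_(i < d.+1 | i != ord_max) w ord0 i * x ord0 i - b) / w ord0 ord_max] => //.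
  move=> u v; rewrite /= andbT => nc q; rewrite inE => /eqP ->.
  apply: nonroots_sign => a auv; apply: contraNN nc.
  rewrite rootE hornerD hornerZ hornerX hornerC => /eqP e.
  suff -> : - (\sum_(i < d.+1 | i != ord_max) w ord0 i * x ord0 i - b) / w ord0 ord_max = a by [].
  apply: (mulIf w0); rewrite divfK//; apply/eqP; rewrite eq_sym -subr_eq0 opprK mulrC.
  by apply/eqP; rewrite -[RHS]e.
exists (B ++ Bl ++ Br).
  by rewrite !size_cat /= -add1n; do 2![apply: leq_add => //].
move=> u v; rewrite !all_cat => /and3P[/HB sgn /Hl[cl Hcl] /Hr[cr Hcr]].
have [vu|uv] := leP v u.
  by exists 0 => a /andP[ua av]; move: (lt_trans ua av); rewrite ltNge vu.
have [c cuv] : exists c, u < c < v by exists ((u + v) / 2); rewrite !midf_lt.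
exists (if 0 <= p.[c] then cl else cr) => a auv /=.
rewrite pE (sgn p (mem_head _ _) a c auv cuv).
by case: ifP => _; [apply: Hcl|apply: Hcr].
Qed.

(** Between the breaks of all trees the combination is constant, hence on one side of 1/2. *)
Lemma dtree_comb_half_breaks d (x : 'rV[R]_d.+1) m (c : 'I_m -> R) (T : 'I_m -> dtree R d.+1) :
  exists2 B : seq R, (size B <= \sum_(i < m) dtree_size (T i))%N &
    half_breaks B (fun a => \sum_(i < m) c i * dtree_eval (T i) (set_last x a)).
Proof.
have /choice[B BP] : forall i : 'I_m, exists Bi : seq R, (size Bi <= dtree_size (T i))%N /\
    forall u v : R, all (fun b => ~~ (u < b < v)) Bi ->
      exists c, forall a, u < a < v -> dtree_eval (T i) (set_last x a) = c.
  move=> i.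
  by have [B] := dtree_breaks x (T i); exists B.
exists (flatten [seq B i | i <- enum 'I_m]).
  rewrite size_flatten /shape -map_comp sumnE big_map enumT.
  by apply: leq_sum => i _; have [] := BP i.
move=> u v u0 uv v1 allB; have [vu|{}uv] := leP v u.
  by left => a /andP[ua av]; move: (lt_trans ua av); rewrite ltNge vu.
have [c0 cuv] : exists c, u < c < v by exists ((u + v) / 2); rewrite !midf_lt.
have cst a : u < a < v -> \sum_(i < m) c i * dtree_eval (T i) (set_last x a) =
    \sum_(i < m) c i * dtree_eval (T i) (set_last x c0).
  move=> auv; apply: eq_bigr => i _; congr (_ * _).
  have [|e He] := (BP i).2 u v; last by rewrite !He.
  apply/allP => b bB; move/allP: allB; apply; apply/flatten_mapP.
  by exists i; rewrite ?mem_enum.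
have [h|/ltW h] := leP (1 / 2) (\sum_(i < m) c i * dtree_eval (T i) (set_last x c0)).
  by left => a /cst ->.
by right => a /cst ->.
Qed.

(** [c] stands for [n t alpha]. Each factor [c be^j + 1] is at most [2 c be^j], the exponents [j]
    add up to ['C(k, 2)], and [be <= c be <= 2^k] bounds the leftover power of [be]. *)
Lemma piece_count_le c be k : (0 < c)%N -> (0 < be)%N -> (0 < k)%N -> (c * be <= 2 ^ k)%N ->
  ((\prod_(j < k) (c * be ^ j).+1) * (be ^ k).+1 <= 2 ^ (k ^ 3 + 2))%N.
Proof.
move=> c0 be0 k0 cbe.
have h1 : (\prod_(j < k) (c * be ^ j).+1 <= be ^ 'C(k, 2) * (2 * c) ^ k)%N.
  apply: (@leq_trans (\prod_(j < k) (be ^ j * (2 * c))))%N.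
    apply: leq_prod => j _; have : (0 < be ^ j)%N by rewrite expn_gt0 be0.
    by move: (be ^ j)%N => e e0; nia.
  by rewrite big_split /= prod_nat_const card_ord -expn_sum -bin2_sum big_mkord.
have h2 : ((be ^ k).+1 <= 2 * be ^ k)%N.
  by rewrite mul2n -addnn -add1n leq_add2r expn_gt0 be0.
apply: leq_trans (leq_mul h1 h2) _.
have -> : (be ^ 'C(k, 2) * (2 * c) ^ k * (2 * be ^ k) =
           2 ^ k.+1 * ((c * be) ^ k * be ^ 'C(k, 2)))%N.
  by rewrite !expnMn expnS; ring.
apply: (@leq_trans (2 ^ k.+1 * ((2 ^ k) ^ k * (2 ^ k) ^ 'C(k, 2))))%N.
  rewrite leq_mul2l; apply/orP; right; apply: leq_mul; first by rewrite leq_exp2r.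
  have [->//|C0] := posnP 'C(k, 2); rewrite leq_exp2r//.
  by apply: leq_trans cbe; rewrite leq_pmull.
rewrite -!expnM -!expnD leq_exp2l//.
(* What remains is [k + 1 + k^2 + k 'C(k, 2) <= k^3 + 2] with [2 'C(k, 2) = k (k - 1)]; at [k = 1]
   both sides are 3. *)
have := mul_bin_diag k 1; rewrite bin1 => e.
have -> : (k ^ 3 = k * (k * k))%N by rewrite !expnS expn0 muln1.
nia.
Qed.

End Breaks.

(** * Iterated tent maps *)

Section Tent.
Variable R : realType.

(** On [0, 1] this is the hat of height 1; the three nested maxima are the three ReLU gates of the
    network. *)
Definition tent (x : R) : R :=
  Num.max 0 (2 * Num.max 0 x - 4 * Num.max 0 (x - 1 / 2)).

Lemma tent_left x : 0 <= x <= 1 / 2 -> tent x = 2 * x.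
Proof.
move=> /andP[x0 x1]; rewrite /tent (max_r x0) (@max_l _ _ 0 (x - _)); last by lra.
by rewrite max_r; lra.
Qed.

Lemma tent_right x : 1 / 2 <= x <= 1 -> tent x = 2 - 2 * x.
Proof.
move=> /andP[x0 x1]; rewrite /tent (@max_r _ _ 0 x) ?(@max_r _ _ 0 (x - _)) ?max_r; lra.
Qed.

Lemma tent_sym x : 0 <= x <= 1 -> tent (1 - x) = tent x.
Proof.
move=> /andP[x0 x1]; have [h|h] := leP x (1 / 2).
  by rewrite tent_right ?tent_left; [lra|rewrite x0 h|apply/andP; split; lra].
by rewrite tent_left ?tent_right; [lra|rewrite x1 ltW|apply/andP; split; lra].
Qed.

(** The first application doubles the left half, sending cell [i] to cell [i] of the coarser grid,
    and reflects the right half, sending it to cell [2^(m+1) - 1 - i] with [s] turned into [1 - s];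
    [tent_sym] undoes the reflection. *)
Lemma iter_tent m i s : (i < 2 ^ m)%N -> 0 <= s <= 1 ->
  iter m.+1 tent ((i%:R + s) / (2 ^ m)%:R) = tent s.
Proof.
elim: m i s => [|m IHm] i s.
  by rewrite expn0 ltnS leqn0 => /eqP -> _; rewrite add0r divr1.
move=> ilt s01; rewrite iterSr.
have p0 : (0 : R) < (2 ^ m)%:R by rewrite ltr0n expn_gt0.
have pS : ((2 ^ m.+1)%:R : R) = 2 * (2 ^ m)%:R by rewrite expnS natrM.
have [im|im] := ltnP i (2 ^ m).
  have -> : tent ((i%:R + s) / (2 ^ m.+1)%:R) = (i%:R + s) / (2 ^ m)%:R.
    rewrite tent_left pS; first by field; rewrite gt_eqF.
    have i0 : (0 : R) <= i%:R by [].
    have {}im : (i%:R : R) + 1 <= (2 ^ m)%:R by rewrite natr1 ler_nat.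
    by apply/andP; split; [rewrite divr_ge0// -?pS//; lra|rewrite ler_pdivrMr ?mulr_gt0//; lra].
  exact: IHm.
have i'E : ((2 ^ m.+1 - i.+1)%:R : R) = 2 * (2 ^ m)%:R - 1 - i%:R.
  by rewrite natrB// -natr1 pS; lra.
have -> : tent ((i%:R + s) / (2 ^ m.+1)%:R) =
    ((2 ^ m.+1 - i.+1)%:R + (1 - s)) / (2 ^ m)%:R.
  rewrite i'E tent_right pS; first by field; rewrite gt_eqF.
  have {}im : ((2 ^ m)%:R : R) <= i%:R by rewrite ler_nat.
  have : (i%:R : R) + 1 <= 2 * (2 ^ m)%:R by rewrite natr1 -pS ler_nat.
  move=> iS; apply/andP; split; first by rewrite ler_pdivlMr ?mulr_gt0//; lra.
  by rewrite ler_pdivrMr ?mulr_gt0//; lra.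
rewrite IHm ?tent_sym//; last by lra.
by rewrite expnS; lia.
Qed.

Lemma tent_gap m (psi : R -> R) (B : seq R) : half_breaks B psi ->
  (2 * size B <= 2 ^ m)%N ->
  ((1 / 64)%:E <= \int[@lebesgue_measure R]_(a in `[0%R, 1%R])
     (`|iter m.+1 tent a - psi a|)%:E)%E.
Proof.
move=> HB sB; set n := (2 ^ m)%N; have n0 : (0 : R) < n%:R by rewrite ltr0n expn_gt0.
pose I := [set i : 'I_n | all (fun b => ~~ (i%:R / n%:R < b < i.+1%:R / n%:R)) B].
have cI : (n <= 2 * #|I|)%N.
  (* Rounding [b n] down recovers the cell hit by the break [b], so no more cells are hit than there
     are breaks. *)
  have : (#|~: I| <= size B)%N.
    rewrite cardE -(size_map val) -(size_map (fun b : R => Num.truncn (b * n%:R)) B).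
    apply: uniq_leq_size; first by rewrite map_inj_uniq ?enum_uniq//; exact: val_inj.
    move=> _ /mapP[i + ->]; rewrite mem_enum !inE => /allPn[b bB].
    rewrite negbK => /andP[ib bi]; apply/mapP; exists b => //; apply/esym/truncn_def.
    by rewrite -ler_pdivrMr// -ltr_pdivlMr// ltW.
  by have := cardsC I; rewrite card_ord; lia.
have HI i : i \in I -> half_cst psi (i%:R / n%:R) (i.+1%:R / n%:R).
  rewrite inE => Bi; apply: HB => //.
    by rewrite ler_pM2r ?invr_gt0// ler_nat.
  by rewrite ler_pdivrMr// mul1r ler_nat.
pose up (i : 'I_n) := `[< forall a, i%:R / n%:R < a < i.+1%:R / n%:R -> 1 / 2 <= psi a >].
(* Both choices lie on the rising half of the triangle, where the iterate is [2 s] at relative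
   position [s]: it is at most 1/4 for [s] below 1/8, against [psi >= 1/2], and at least 3/4 for [s]
   from 3/8 to 1/2, against [psi <= 1/2]. *)
pose l (i : 'I_n) : R := if up i then i%:R / n%:R else (i%:R + 3 / 8) / n%:R.
pose r (i : 'I_n) : R := if up i then (i%:R + 1 / 8) / n%:R else (i%:R + 1 / 2) / n%:R.
apply: le_trans (@integral_01_ge_pieces R n I l r _ (1 / 4) (1 / 8 / n%:R) _ _ _ _).
- rewrite lee_fin; have : ((n%:R : R) <= 2 * #|I|%:R) by rewrite -natrM ler_nat.
  rewrite mulrA mulrA ler_pdivlMr//; lra.
- by lra.
- by move=> a _; rewrite lee_fin.
- move=> i iI; rewrite /l /r; split.
  + by case: ifP => // _; rewrite ler_pM2r ?invr_gt0//; lra.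
  + by case: ifP => _; rewrite ler_pM2r ?invr_gt0// -[i.+1%:R]natr1; lra.
  + rewrite divr_gt0//=.
    by case: ifP => _; rewrite -mulrBl ler_pM2r ?invr_gt0//; lra.
- move=> i iI a alr; rewrite lee_fin.
  pose s := a * n%:R - i%:R.
  have aE : a = (i%:R + s) / n%:R by rewrite /s addrC subrK mulfK// gt_eqF.
  have sE (x y : R) : (i%:R + x) / n%:R < a < (i%:R + y) / n%:R -> x < s < y.
    by rewrite /s ltr_pdivrMr// ltr_pdivlMr//; lra.
  have fE : 0 <= s <= 1 / 2 -> iter m.+1 tent a = 2 * s.
    move=> /andP[s0 s1]; rewrite aE iter_tent ?tent_left//; lra.
  have aP : 0 < s < 1 -> i%:R / n%:R < a < i.+1%:R / n%:R.
    by rewrite /s ltr_pdivrMr// ltr_pdivlMr// -[i.+1%:R]natr1; lra.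
  move: alr; rewrite /l /r; case: ifPn => [/asboolP psi_ge alr|/asboolP psi_lt /sE s01].
    have s01 : 0 < s < 1 / 8 by apply: sE; rewrite addr0.
    have pa : 1 / 2 <= psi a by apply/psi_ge/aP; lra.
    by rewrite fE ?ler0_norm; lra.
  have [//|psi_le] := HI i iI.
  have pa : psi a <= 1 / 2 by apply/psi_le/aP; lra.
  by rewrite fE ?ger0_norm; lra.
Qed.

End Tent.

(** * The ReLU network *)

Lemma bigmax_iota_mono (F : nat -> nat) e : {homo F : p q / (p <= q)%N} ->
  \max_(p <- iota 0 e.+1) F p = F e.
Proof.
move=> hF; apply/eqP; rewrite eqn_leq; apply/andP; split.
  by apply/bigmax_leqP_seq => p; rewrite mem_iota ltnS /= => pe _; apply: hF.
by apply: (@leq_bigmax_seq _ _ xpredT F) => //; rewrite mem_iota /= ltnS.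
Qed.

Section TentNetwork.
Variable R : realType.
Variables (d M : nat).

(* Gates 3q, 3q+1, 3q+2 compute the q-th tent map.  Every gate reads all nodes
   of earlier layers, almost all with weight 0, so that the last gate is the
   only node without outgoing edges. *)
Definition tent_par (j : nat) : seq nat := iota 0 (d.+1 + j - (j %% 3 == 1)%N).

(** Index 4, and every later one, has the value -1/2 through the default of [nth]. *)
Definition tent_weight (i : 'I_(4 + d.+1)) : R :=
  nth (- (1 / 2)) [:: 0; 1; 2; - 4] i.

Definition tent_index (i : nat) : 'I_(4 + d.+1) := @inord (4 + d) i.

(** Values are parameter indices. Gate 3q+2 puts weights 2 and -4 on the two gates before it; the
    others put weight 1 on their last parent, the previous tent output for both since gate 3q+1 does
    not read gate 3q. *)
Definition tent_coef (j i : nat) : nat :=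
  let s := size (tent_par j) in
  if (j %% 3 == 2)%N then (if i == s.-1 then 3 else if i == s.-2 then 2 else 0)%N
  else (i == s.-1)%N.

Definition tent_bias (j : nat) : nat := if (j %% 3 == 1)%N then 4 else 0.

Definition tent_gate j (v : 'I_(size (tent_par j)) -> R) : R :=
  Num.max 0 (\sum_(i < size (tent_par j)) tent_weight (tent_index (tent_coef j i)) * v i
             + tent_weight (tent_index (tent_bias j))).

Definition tent_net : network R d.+1 := @Network R d.+1 (3 * M) tent_par tent_gate.

Lemma tent_weightE i : (i < 5)%N ->
  tent_weight (tent_index i) = nth (- (1 / 2)) [:: 0; 1; 2; - 4] i.
Proof. by move=> i5; rewrite /tent_weight /tent_index inordK//; lia. Qed.

Hypothesis M0 : (0 < M)%N.

Lemma tent_net_wf : net_wf tent_net.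
Proof.
split; first by rewrite addSn.
split=> [j _|v vlt] /=.
  by apply/allP => p; rewrite mem_iota; lia.
(* The last gate has index 2 modulo 3, so it reads every other node. *)
exists (3 * M).-1; rewrite /= ?mem_iota; move: vlt => /=; lia.
Qed.

(** Two layers per tent map, its first two gates sharing one; truncated subtraction gives all inputs
    depth 0. *)
Definition tent_depth (p : nat) : nat := ((p - d) %/ 3 * 2 + ((p - d) %% 3 != 0))%N.

Lemma tent_depth_mono : {homo tent_depth : p q / (p <= q)%N}.
Proof. by move=> p q pq; rewrite /tent_depth; lia. Qed.

(** Parents form an initial segment and depth grows with the numbering, so the maximum is attained
    at the last parent [e]. *)
Lemma node_depth_tent_net p : (p < d.+1 + 3 * M)%N -> node_depth tent_net p = tent_depth p.
Proof.
elim/ltn_ind: p => p IHp pn; have [pd|dp] := ltnP p d.+1.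
  by rewrite node_depth_input// /tent_depth; lia.
have pE : p = (d.+1 + (p - d.+1))%N by rewrite subnKC.
rewrite {1}pE (node_depth_gate tent_net_wf) /=; last by lia.
set j := (p - d.+1)%N; set e := (d + j - (j %% 3 == 1))%N.
have -> : tent_par j = iota 0 e.+1 by rewrite /tent_par /e; congr iota; lia.
rewrite (eq_big_seq tent_depth) => [|q].
  by rewrite bigmax_iota_mono; [rewrite /tent_depth /e /j; lia|exact: tent_depth_mono].
by rewrite mem_iota /= => qe; apply: IHp; rewrite /e /j in qe; lia.
Qed.

Lemma tent_net_layers : net_layers tent_net = (2 * M)%N.
Proof.
rewrite /net_layers; have -> : net_depths tent_net (net_n tent_net) =
    [seq tent_depth p | p <- iota 0 (d + 3 * M).+1].
  apply: (@eq_from_nth _ 0%N); first by rewrite size_net_depths size_map size_iota.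
  rewrite size_net_depths => i ilt; rewrite -[LHS]/(node_depth tent_net i).
  rewrite node_depth_tent_net// (nth_map 0%N) ?size_iota// nth_iota//.
rewrite big_map bigmax_iota_mono; last exact: tent_depth_mono.
by rewrite /tent_depth; lia.
Qed.

Lemma node_val_tent_net x j : (j < 3 * M)%N -> node_val tent_net x (d.+1 + j) =
  Num.max 0 (\sum_(i < size (tent_par j))
      nth (- (1 / 2)) [:: 0; 1; 2; - 4] (tent_coef j i) * node_val tent_net x i
    + nth (- (1 / 2)) [:: 0; 1; 2; - 4] (tent_bias j)).
Proof.
move=> jM; rewrite node_val_gate//; last exact: tent_net_wf.
rewrite /= /tent_gate tent_weightE; last by rewrite /tent_bias; case: ifP.
congr (Num.max 0 (_ + _)); apply: eq_bigr => i _.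
rewrite tent_weightE; last by rewrite /tent_coef; case: ifP => _; [do 2?case: ifP|case: (_ == _)].
by rewrite /tent_par nth_iota//; apply: leq_trans (ltn_ord i) _; rewrite size_iota.
Qed.

Lemma node_val_tent_copy x j : (j < 3 * M)%N -> (j %% 3 != 2)%N ->
  node_val tent_net x (d.+1 + j) = Num.max 0
    (node_val tent_net x (d + j - (j %% 3 == 1))%N
     + nth (- (1 / 2)) [:: 0; 1; 2; - 4] (tent_bias j)).
Proof.
move=> jM j2; rewrite node_val_tent_net// /tent_coef (negbTE j2) /=.
have -> : size (tent_par j) = (d + j - (j %% 3 == 1)%N).+1 by rewrite size_iota; lia.
rewrite big_ord_recr /= eqxx /= [1 * node_val _ _ _]mul1r big1 ?add0r// => i _.
by rewrite ltn_eqF ?mul0r.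
Qed.

Lemma node_val_tent_comb x j : (j < 3 * M)%N -> (j %% 3 == 2)%N ->
  node_val tent_net x (d.+1 + j) = Num.max 0
    (2 * node_val tent_net x (d.+1 + j.-2) - 4 * node_val tent_net x (d.+1 + j.-1)).
Proof.
move=> jM j2; rewrite node_val_tent_net// /tent_coef j2 /=.
have -> : tent_bias j = 0%N by rewrite /tent_bias; case: ifP => //; lia.
have -> : size (tent_par j) = (d.+1 + j.-2).+2 by rewrite size_iota; lia.
have -> : (d.+1 + j.-1 = (d.+1 + j.-2).+1)%N by lia.
move: (d.+1 + j.-2)%N => e; rewrite 2!big_ord_recr /= !eqxx ltn_eqF// big1 => [|i _] /=.
  by rewrite add0r addr0 mulNr.
by rewrite !ltn_eqF ?mul0r//; have := ltn_ord i; lia.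
Qed.

(** Node [d] is the last input coordinate; for [q > 0], node [d + 3 * q] is the third gate of the
    [q]-th tent map. *)
Lemma node_val_tent_iter x q : (q <= M)%N ->
  node_val tent_net x (d + 3 * q) = iter q (@tent R) (x ord0 ord_max).
Proof.
elim: q => [|q IHq] qM.
  by rewrite muln0 addn0 -[d]/(val (@ord_max d)) node_val_input.
have -> : (d + 3 * q.+1 = d.+1 + (3 * q).+2)%N by lia.
rewrite node_val_tent_comb; [|lia|lia].
rewrite !node_val_tent_copy; [|lia|lia|lia|lia].
have -> : (d + (3 * q).+2.-2 - ((3 * q).+2.-2 %% 3 == 1) = d + 3 * q)%N by lia.
have -> : (d + (3 * q).+2.-1 - ((3 * q).+2.-1 %% 3 == 1) = d + 3 * q)%N by lia.
have -> : tent_bias (3 * q).+2.-2 = 0%N by rewrite /tent_bias; case: ifP => //; lia.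
have -> : tent_bias (3 * q).+2.-1 = 4%N by rewrite /tent_bias; case: ifP => //; lia.
by rewrite IHq ?(ltnW qM)//= addr0.
Qed.

Lemma tent_net_computes :
  relu_net_computes (2 * M) (3 * M) (4 + d.+1)
    (fun x : 'rV[R]_d.+1 => iter M (@tent R) (x ord0 ord_max)).
Proof.
exists tent_weight, tent_net; split=> //.
- exact: tent_net_wf.
- by move=> j _; exists (fun i => tent_index (tent_coef j i)), (tent_index (tent_bias j)).
- exact: tent_net_layers.
- by move=> x; rewrite -node_val_tent_iter.
Qed.

End TentNetwork.

(** * Break counts for both classes and the final bound *)

Lemma sa_net_line_breaks (R : realType) k d t al be (g : 'rV[R]_d.+1 -> R) (x : 'rV[R]_d.+1) :
  (0 < k)%N -> (0 < t)%N -> (0 < al)%N -> (0 < be)%N ->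
  sa_net_computes t al be k (2%:R ^+ k / (t * al * be)%:R) g ->
  exists2 B : seq R, half_breaks B (fun a => g (set_last x a)) &
    (size B <= 2 ^ (k ^ 3 + 2))%N.
Proof.
move=> k0 t0 al0 be0 [N [wf sa Lk nodes gE]].
have -> : (fun a => g (set_last x a)) = (fun a => net_eval N (set_last x a)).
  by apply/funext => a; rewrite gE.
(* [piece_count_le] takes a positive [c]; a network without gates has depth 0 and at most one
   break. *)
have [n0|n0] := posnP (net_n N).
  have L0 : (net_layers N <= 0)%N.
    rewrite /net_layers n0; apply/bigmax_leqP_seq => v.
    by rewrite -[net_depths N 0]/(nseq d.+1 0%N) mem_nseq => /andP[_ /eqP ->].
  have [B] := sa_net_half_breaks x wf be0 sa L0.
  rewrite big_ord0 mul1n expn0 ltnS => sB HB; exists B => //.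
  by apply: leq_trans sB _; rewrite expn_gt0.
have [B sB HB] := sa_net_half_breaks x wf be0 sa Lk.
exists B => //; apply: leq_trans (ltnW sB) _; apply: piece_count_le => //.
  by rewrite !muln_gt0 n0 t0.
move: nodes; rewrite ler_pdivlMr ?ltr0n ?muln_gt0 ?t0 ?al0// -natrX -natrM ler_nat.
by rewrite /net_nodes !mulnA.
Qed.

Lemma dtree_comb_line_breaks (R : realType) K d t (g : 'rV[R]_d.+1 -> R) (x : 'rV[R]_d.+1) :
  (0 < t)%N -> dtree_comb_computes t (2%:R ^+ K / t%:R) g ->
  exists2 B : seq R, half_breaks B (fun a => g (set_last x a)) & (size B <= 2 ^ K)%N.
Proof.
move=> t0 [m [c [T [mt Tsize gE]]]].
have -> : (fun a => g (set_last x a)) =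
    (fun a => \sum_(i < m) c i * dtree_eval (T i) (set_last x a)).
  by apply/funext => a; rewrite gE.
have [B sB HB] := dtree_comb_half_breaks x c T.
(* Multiplying by [t] clears the denominator: [m <= t] trees with [t * dtree_size (T i) <= 2 ^ K]
   each. *)
exists B => //; apply: leq_trans sB _; rewrite -(leq_pmul2r t0) big_distrl /=.
apply: (@leq_trans (\sum_(i < m) 2 ^ K)%N).
  apply: leq_sum => i _; have := Tsize i.
  by rewrite ler_pdivlMr ?ltr0n// -natrX -natrM ler_nat.
by rewrite sum_nat_const card_ord mulnC leq_mul2l mt orbT.
Qed.

Theorem theorem1p1 (R : realType) (k d t alpha beta : nat) :
  (1 <= k)%N -> (1 <= d)%N -> (1 <= t)%N -> (1 <= alpha)%N -> (1 <= beta)%N ->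
  exists f : 'rV[R]_d -> R,
    relu_net_computes (2 * k ^ 3 + 8) (3 * k ^ 3 + 12) (4 + d) f /\
    forall g : 'rV[R]_d -> R,
      (sa_net_computes t alpha beta k
          (2%:R ^+ k / (t * alpha * beta)%:R) g \/
       dtree_comb_computes t (2%:R ^+ (k ^ 3) / t%:R) g) ->
      ((1 / 64)%:E <= cube_integral (fun x => (`|f x - g x|)%:E))%E.
Proof.
move=> k0; case: d => [//|d] _ t0 al0 be0.
exists (fun x => iter (k ^ 3 + 4) (@tent R) (x ord0 ord_max)); split.
  (* Each of the [k^3 + 4] tent maps takes two layers and three gates. *)
  have := @tent_net_computes R d (k ^ 3 + 4); rewrite !mulnDr; apply.
  by rewrite addnS.
move=> g gC; apply: cube_integral_ge_last => [|x]; first by lra.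
have [B HB sB] : exists2 B : seq R, half_breaks B (fun a => g (set_last x a)) &
    (2 * size B <= 2 ^ (k ^ 3 + 3))%N.
  (* The allowed number of breaks is exactly half the number of triangles. *)
  have E : (2 ^ (k ^ 3 + 3) = 2 * 2 ^ (k ^ 3 + 2))%N by rewrite addnS expnS.
  case: gC => [/(@sa_net_line_breaks _ _ _ _ _ _ _ x k0 t0 al0 be0)|].
    by move=> [B HB sB]; exists B; rewrite // E leq_mul2l sB.
  move=> /(@dtree_comb_line_breaks _ _ _ _ _ x t0) [B HB sB]; exists B => //.
  by rewrite E leq_mul2l (leq_trans sB)// leq_pexp2l// leq_addr.
have -> : (fun a : R => (`|iter (k ^ 3 + 4) (@tent R) (set_last x a ord0 ord_max)
    - g (set_last x a)|)%:E) =
    (fun a => (`|iter (k ^ 3 + 3).+1 (@tent R) a - g (set_last x a)|)%:E).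
  by apply/funext => a; rewrite mxE eqxx -addnS.
exact: tent_gap HB sB.
Qed.
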